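(* Let $E$ be a countably Dedekind complete Riesz space and let $S$ be a self-map on $E$. Suppose that (i) there exist an $h\in E$ and an order continuous linear operator $K$ on $E$ such that $Sv=h+Kv$ for all $v\in E$, and (ii) there exist an $e\in E$ and a $\rho\in[0,1)$ with $|h|\le e$ and $Ke\le\rho e$. Then $S$ has a unique fixed point $\bar v$ in the order interval $V:=[-e/(1-\rho),\,e/(1-\rho)]$ and, moreover, $S^n v\stackrel{o}{\to}\bar v$ for any $v\in V$.
   Context: For elements $v\le w$ of a poset, $[v,w]=\{u:v\le u\le w\}$ is an order interval. A Riesz space $E$ is countably Dedekind complete if, in every order interval, every countable chain has a supremum and an infimum in that interval. Write $v_n\uparrow v$ if $(v_n)$ is increasing with supremum $v$, and $v_n\downarrow v$ if it is decreasing with infimum $v$. A self-map $K$ on $E$ is order continuous if $v_n\uparrow v$ in $E$ implies $Kv_n\uparrow Kv$ (in particular the supremum exists). A sequence $(v_n)$ in $E$ order converges to $v\in E$, written $v_n\stackrel{o}{\to}v$, if there is a sequence $d_n\downarrow0$ in $E$ with $|v_n-v|\le d_n$ for all $n\in\mathbb N$. *)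

(* Defs.v *)
From HB Require Import structures.
From mathcomp Require Import all_boot all_order all_algebra.
From mathcomp Require Import boolp classical_sets functions set_interval.
From mathcomp Require Import cardinality reals sequences.

Set Implicit Arguments.
Unset Strict Implicit.
Unset Printing Implicit Defensive.

Import Order.TTheory GRing.Theory Num.Theory.

Local Open Scope classical_set_scope.
Local Open Scope ring_scope.

(* The binary suprema and infima of a Riesz space are operations specified as in
   Order.Lattice; they are not inherited from Order.Lattice because
   Hierarchy-Builder has no join of the semilattice and additive structures
   below Num.RealDomain. *)
HB.mixin Record POrderedLmodule_isRiesz (R : realType) E
    of Num.POrderedZmodule E & GRing.Lmodule R E := {
  riesz_leD2r : forall x y z : E, x <= y -> x + z <= y + z;
  riesz_scale_ge0 : forall (a : R) (x : E), 0 <= a -> 0 <= x -> 0 <= a *: x;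
  riesz_join : E -> E -> E;
  riesz_meet : E -> E -> E;
  riesz_leUx : forall x y z : E,
    (riesz_join x y <= z) = (x <= z) && (y <= z);
  riesz_lexI : forall x y z : E,
    (x <= riesz_meet y z) = (x <= y) && (x <= z)
}.

#[short(type="rieszType")]
HB.structure Definition Riesz (R : realType) :=
  { E of Num.POrderedZmodule E & GRing.Lmodule R E
       & POrderedLmodule_isRiesz R E }.

Definition riesz_abs (R : realType) (E : rieszType R) (x : E) : E :=
  riesz_join x (- x).

(* Suprema and infima of C computed in the subposet P; for C empty and P an
   interval [set` `[a, b]] with a <= b they are a and b respectively. *)
Definition supremums_in d (T : porderType d) (P C : set T) : set T :=
  (P `&` ubound C) `&` lbound (P `&` ubound C).

Definition infimums_in d (T : porderType d) (P C : set T) : set T :=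
  (P `&` lbound C) `&` ubound (P `&` lbound C).

Definition countably_dedekind_complete d (T : porderType d) : Prop :=
  forall (a b : T) (C : set T), (a <= b)%O ->
    C `<=` [set` `[a, b]%O] -> countable C ->
    total_on C (fun x y => (x <= y)%O) ->
    supremums_in [set` `[a, b]%O] C !=set0 /\
    infimums_in [set` `[a, b]%O] C !=set0.

Definition increases_to d (T : porderType d) (u : nat -> T) (v : T) : Prop :=
  nondecreasing_seq u /\ supremums (range u) v.

Definition decreases_to d (T : porderType d) (u : nat -> T) (v : T) : Prop :=
  nonincreasing_seq u /\ infimums (range u) v.

(* On the sequence v, w, w, w, ... with v <= w, this forces K v <= K w. *)
Definition order_continuous d (T : porderType d) (K : T -> T) : Prop :=
  forall (u : nat -> T) (v : T),
    increases_to u v -> increases_to (K \o u) (K v).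

Definition order_converges (R : realType) (E : rieszType R)
    (u : nat -> E) (v : E) : Prop :=
  exists2 d : nat -> E, decreases_to d 0 &
    forall n, riesz_abs (u n - v) <= d n.

(* Main.v *)
(** Order continuity makes [K] positive, so [S] is isotone and maps [V] into
    itself.  Started at the bottom of [V], its iterates increase; their supremum
    is a fixed point by order continuity of [K].  For [v] and [w] in [V],
    [|S^n v - S^n w| <= rho^n (2 / (1 - rho)) e], and this bound decreases to 0
    because its infimum [m >= 0] satisfies [m <= rho m]. This gives uniqueness
    and order convergence. *)
Require Import Defs.
From mathcomp Require Import all_boot all_order all_algebra.
From mathcomp Require Import boolp classical_sets functions set_interval.
From mathcomp Require Import cardinality reals sequences.
Set Implicit Arguments.
Unset Strict Implicit.
Unset Printing Implicit Defensive.
Import Order.TTheory GRing.Theory Num.Theory.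
Local Open Scope classical_set_scope.
Local Open Scope ring_scope.

Lemma order_continuous_homo d (T : porderType d) (K : T -> T) :
  order_continuous K -> {homo K : x y / (x <= y)%O}.
Proof.
move=> hK x y xy.
pose u n := if n is _.+1 then y else x.
have [] // := hK u y.
  split; first by apply/nondecreasing_seqP => -[|n] /=.
  split; first by move=> _ [[|n] _ <-] /=.
  by move=> z; apply; exists 1%N.
by move=> _ [ub _]; apply: ub; exists 0%N.
Qed.

Section RieszTheory.
Variables (R : realType) (E : rieszType R).
Implicit Types (x y z t : E) (a b : R).

Lemma riesz_leD x y z t : x <= y -> z <= t -> x + z <= y + t.
Proof.
move=> xy zt; apply: le_trans (riesz_leD2r x y z xy) _.
by rewrite ![y + _]addrC; apply: riesz_leD2r.
Qed.

Lemma riesz_subr_ge0 x y : (0 <= y - x) = (x <= y).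
Proof.
apply/idP/idP => [/(riesz_leD2r _ _ x)|/(riesz_leD2r _ _ (- x))].
  by rewrite add0r subrK.
by rewrite subrr.
Qed.

Lemma riesz_leN2 x y : (- x <= - y) = (y <= x).
Proof. by rewrite -[LHS]riesz_subr_ge0 opprK addrC riesz_subr_ge0. Qed.

Lemma riesz_leZl a x y : 0 <= a -> x <= y -> a *: x <= a *: y.
Proof.
move=> a0; rewrite -riesz_subr_ge0 -[a *: x <= _]riesz_subr_ge0 -scalerBr.
exact: riesz_scale_ge0.
Qed.

Lemma riesz_leZr x a b : 0 <= x -> a <= b -> a *: x <= b *: x.
Proof.
by move=> x0 ab; rewrite -riesz_subr_ge0 -scalerBl riesz_scale_ge0 ?subr_ge0.
Qed.

Lemma riesz_abs_le x y : (riesz_abs x <= y) = (- y <= x) && (x <= y).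
Proof. by rewrite riesz_leUx andbC -[- x <= y]riesz_leN2 opprK. Qed.

(** Since [- y <= x <= y], the element [y + y] is nonnegative, and scaling by 1/2 preserves this. *)
Lemma riesz_abs_le_ge0 x y : riesz_abs x <= y -> 0 <= y.
Proof.
rewrite riesz_abs_le => /andP[Nyx xy].
have yNy : - y <= y := le_trans Nyx xy.
have h0 : 0 <= 2^-1 :> R by rewrite invr_ge0 ler0n.
move: yNy; rewrite -[- y <= y]riesz_subr_ge0 opprK => /(riesz_scale_ge0 _ _ h0).
by rewrite -mulr2n -scaler_nat scalerA mulVf ?scale1r // pnatr_eq0.
Qed.

Lemma riesz_increases_toD x (u : nat -> E) y :
  increases_to u y -> increases_to (fun n => x + u n) (x + y).
Proof.
move=> [u_nd [u_ub u_lub]]; split.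
  by move=> m n mn; apply: riesz_leD => //; apply: u_nd.
split=> [_ [n _ <-]|z z_ub].
  by apply: riesz_leD => //; apply: u_ub; exists n.
suff /(riesz_leD (lexx x)): y <= z - x by rewrite [x + (z - x)]addrC subrK.
apply: u_lub => _ [n _ <-].
have /(riesz_leD2r _ _ (- x)) : x + u n <= z by apply: z_ub; exists n.
by rewrite [x + u n]addrC addrK.
Qed.

Hypothesis hE : countably_dedekind_complete E.

(* A supremum in [[a, b]] is a supremum in E: cut upper bounds down to [b]. *)
Lemma riesz_increases_to_bounded x y (u : nat -> E) :
    nondecreasing_seq u -> (forall n, x <= u n <= y) ->
  exists2 v, x <= v <= y & increases_to u v.
Proof.
move=> u_nd uxy.
have xy : x <= y by have /andP[] := uxy 0%N; apply: le_trans.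
have [||| [v [[/= vxy v_ub] v_lub]] _] := hE (C := range u) xy.
- by move=> _ [n _ <-] /=; rewrite in_itv /= uxy.
- exact: card_image_le.
- move=> _ _ [m _ <-] [n _ <-].
  by case/orP: (leq_total m n) => /u_nd; [left|right].
exists v; first by move: vxy; rewrite in_itv.
split=> //; split=> // z z_ub.
suff : v <= riesz_meet z y by rewrite riesz_lexI => /andP[].
apply: v_lub; split=> /=.
  rewrite in_itv /= riesz_lexI xy andbT.
  have := lexx (riesz_meet z y); rewrite riesz_lexI => /andP[_ ->].
  (* The cut-down bound stays above [x] because [z] dominates [u 0]. *)
  rewrite andbT; have /andP[xu0 _] := uxy 0%N.
  by apply: le_trans xu0 _; apply: z_ub; exists 0%N.
move=> w uw; rewrite riesz_lexI z_ub //=.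
by case: uw => n _ <-; have /andP[] := uxy n.
Qed.

(** An Archimedean-type property extracted from countable completeness. The sequence is negated so
    that the previous existence result yields a supremum [v]. Every lower bound [z] satisfies
    [v <= - z], so it suffices that [v] is nonnegative. *)
Lemma riesz_decreases_to_expr x a : 0 <= x -> 0 <= a < 1 ->
  decreases_to (fun n => a ^+ n *: x) 0.
Proof.
move=> x0 /andP[a0 a1].
have aS n : a ^+ n.+1 <= a ^+ n by rewrite exprS ler_piMl ?exprn_ge0 // ltW.
have ax_ni : nonincreasing_seq (fun n => a ^+ n *: x).
  by apply/nonincreasing_seqP => n; apply: riesz_leZr.
split=> //; split=> [_ [n _ <-]|z z_lb].
  by apply: riesz_scale_ge0 => //; apply: exprn_ge0.
have [|n|v /andP[_ v0] [_ [v_ub v_lub]]] :=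
    @riesz_increases_to_bounded (- x) 0 (fun n => - (a ^+ n *: x)).
- by move=> m n mn; rewrite riesz_leN2; apply: ax_ni.
- rewrite riesz_leN2 -{2}[x]scale1r riesz_leZr ?exprn_ile1 ?(ltW a1) //=.
  by rewrite -oppr0 riesz_leN2 riesz_scale_ge0 ?exprn_ge0.
have zv : v <= - z.
  by apply: v_lub => _ [n _ <-]; rewrite riesz_leN2; apply: z_lb; exists n.
suff v_ge0 : 0 <= v.
  by rewrite -[z]opprK -oppr0 riesz_leN2; apply: le_trans zv.
(* Division by [a] is excluded here, but the term of index 1 is already 0; the term of index 0 is
   [x]. *)
have [a_eq0|a_neq0] := eqVneq a 0.
  have : - (a ^+ 1 *: x) <= v by apply: v_ub; exists 1%N.
  by rewrite a_eq0 expr1 scale0r oppr0.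
have ai0 : 0 <= a^-1 by rewrite invr_ge0.
(* Dividing the bound on term [n.+1] by [a] bounds term [n], so [a^-1 *: v] is again an upper
   bound. *)
have av : v <= a^-1 *: v.
  apply: v_lub => _ [n _ <-].
  have /(riesz_leZl ai0) : - (a ^+ n.+1 *: x) <= v by apply: v_ub; exists n.+1.
  by rewrite scalerN scalerA exprS mulKf.
have a_lt : 0 < a^-1 - 1 by rewrite subr_gt0 invf_gt1 // lt_def a_neq0.
move: av; rewrite -riesz_subr_ge0 -{2}[v]scale1r -scalerBl.
move=> /(riesz_scale_ge0 (a^-1 - 1)^-1 _).
by rewrite scalerA mulVf ?scale1r ?gt_eqF //; apply; rewrite invr_ge0 ltW.
Qed.

End RieszTheory.

Lemma increases_to_unique d (T : porderType d) (u : nat -> T) (v w : T) :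
  increases_to u v -> increases_to u w -> v = w.
Proof.
move=> [_ [v_ub v_lub]] [_ [w_ub w_lub]].
by apply/le_anti; rewrite v_lub ?w_lub.
Qed.

Lemma increases_to_shift d (T : porderType d) (u : nat -> T) (v : T) :
  increases_to u v -> increases_to (fun n => u n.+1) v.
Proof.
move=> [u_nd [u_ub u_lub]]; split; first by move=> m n mn; apply: u_nd.
split=> [_ [n _ <-]|z z_ub]; first by apply: u_ub; exists n.+1.
apply: u_lub => _ [n _ <-]; apply: le_trans (u_nd _ _ (leqnSn n)) _.
by apply: z_ub; exists n.
Qed.

Theorem theorem4p5 (R : realType) (E : rieszType R)
    (hE : countably_dedekind_complete E) (S : E -> E)
    (h : E) (K : {linear E -> E}) (hK : order_continuous K)
    (hS : forall v : E, S v = h + K v)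
    (e : E) (rho : R) (hrho : 0 <= rho < 1)
    (he : riesz_abs h <= e) (hKe : K e <= rho *: e) :
  let V : set E :=
    [set` `[- ((1 - rho)^-1 *: e), (1 - rho)^-1 *: e]] in
  exists vbar : E,
    unique (fun v : E => V v /\ S v = v) vbar /\
    forall v : E, V v -> order_converges (fun n => iter n S v) vbar.
Proof.
move=> V; have K_homo := order_continuous_homo hK.
have e_ge0 := riesz_abs_le_ge0 he.
have /andP[rho_ge0 rho_lt1] := hrho.
set c := (1 - rho)^-1 in V *.
have c_ge0 : 0 <= c by rewrite invr_ge0 subr_ge0 ltW.
(* [c] is the sum of the geometric series in [rho]; this identity is what makes [S] send both
   endpoints of [V] back into [V]. *)
have cE : 1 + c * rho = c.
  apply/eqP; rewrite eq_sym -subr_eq -{1}[c]mulr1 -mulrBr mulVf //.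
  by rewrite subr_eq0 gt_eqF.
have S_homo : {homo S : v w / v <= w}.
  by move=> v w vw; rewrite !hS; apply: riesz_leD => //; apply: K_homo.
have Kce : K (c *: e) <= (c * rho) *: e.
  by rewrite linearZ -scalerA; apply: riesz_leZl.
have ceE : c *: e = e + (c * rho) *: e.
  by rewrite -{1}cE scalerDl scale1r.
move: (he); rewrite riesz_abs_le => /andP[h_ge h_le].
have S_top : S (c *: e) <= c *: e.
  by rewrite hS {2}ceE; apply: riesz_leD.
have S_bot : - (c *: e) <= S (- (c *: e)).
  by rewrite hS {1}ceE opprD linearN; apply: riesz_leD; rewrite // riesz_leN2.
have VE v : V v <-> - (c *: e) <= v <= c *: e by rewrite /V /= in_itv.
have V_iter v n : V v -> V (iter n S v).
  move=> Vv; elim: n => //= n /VE/andP[vl vr]; apply/VE/andP; split.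
    exact: le_trans S_bot (S_homo _ _ vl).
  exact: le_trans (S_homo _ _ vr) S_top.
pose u n := iter n S (- (c *: e)).
have V_bot : V (- (c *: e)).
  apply/VE; rewrite lexx /=; have ce_ge0 := riesz_scale_ge0 _ _ c_ge0 e_ge0.
  by apply: le_trans (ce_ge0); rewrite -oppr0 riesz_leN2.
have u_nd : nondecreasing_seq u.
  by apply/nondecreasing_seqP; elim=> [|n IH] //=; apply: S_homo.
have u_bd n : - (c *: e) <= u n <= c *: e by apply/VE/V_iter.
have [vbar /VE Vvbar u_vbar] := riesz_increases_to_bounded hE u_nd u_bd.
have S_vbar : S vbar = vbar.
  (* The shifted sequence [S (u n)] increases to [vbar], and by order continuity of [K] also to
     [h + K vbar]. *)
  apply: (increases_to_unique _ (increases_to_shift u_vbar)).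
  rewrite hS; have := riesz_increases_toD h (hK _ _ u_vbar).
  by congr increases_to; apply/funext => n /=; rewrite -hS.
(* [d 0] is the width of [V]; each application of [K] shrinks the bound by a factor [rho]. *)
pose d n := rho ^+ n *: (c *: e + c *: e).
have d_to0 : decreases_to d 0.
  apply: riesz_decreases_to_expr => //.
  by rewrite -[0]addr0 riesz_leD ?riesz_scale_ge0.
have Kd n : K (d n) <= d n.+1.
  rewrite /d linearZ exprSr -scalerA; apply: riesz_leZl; first exact: exprn_ge0.
  rewrite linearD scalerDr scalerA [rho * c]mulrC.
  exact: riesz_leD.
(* The one-sided bound suffices: exchanging [v] and [w] gives the absolute value. In the induction
   [h] cancels, leaving [K] of the previous difference. *)
have dist v w n : V v -> V w -> iter n S v - iter n S w <= d n.
  move=> /VE/andP[_ vr] /VE/andP[wl _]; elim: n => [|n IH] /=.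
    rewrite /d expr0 scale1r; apply: riesz_leD => //.
    by rewrite -[c *: e]opprK riesz_leN2.
  rewrite !hS [h + _]addrC addrKA -linearB; exact: le_trans (K_homo _ _ IH) (Kd n).
have iter_vbar n : iter n S vbar = vbar by elim: n => //= n ->.
have abs_dist v n : V v -> riesz_abs (iter n S v - vbar) <= d n.
  move=> Vv; rewrite -(iter_vbar n) riesz_leUx opprB.
  by rewrite !dist.
exists vbar; split; last by move=> v Vv; exists d => // n; apply: abs_dist.
split=> // v [Vv S_v].
have iter_v n : iter n S v = v by elim: n => //= n ->.
(* Both points are fixed, so this constant is a lower bound of [d], whose infimum is 0. *)
have : riesz_abs (v - vbar) <= 0.
  case: d_to0 => _ [_]; apply=> _ [n _ <-].
  by rewrite -{1}(iter_v n); apply: abs_dist.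
rewrite riesz_abs_le oppr0 => /le_anti /esym/eqP.
by rewrite subr_eq0 => /eqP.
Qed.
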